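(* Let $\mu\in(0,\infty)$, let $m=m_n$ and let $n,m\to+\infty$ with $m/n\to\mu$. Assume that $P^{(n)}$ converges weakly to some probability measure $P$ on $\mathbb{Z}_+\times[0,1]$ and that $P^{(n)}_{10}$ converges to $P_{10}\in(0,\infty)$. Fix $s,t\in\mathbb{N}$. For $M>0$ let $\hat d_i=\deg_{\hat G}(i)$, where $\hat G=([n],E(\hat G))$ is the graph with $E(\hat G)=\bigcup_{k:\,X_{n,k}\le M}E(G_{n,k})$, and let $D_i=D_{n,i}=\deg_{G_n}(i)$, $i=1,2$. Then, as $M\to\infty$, $$\sup_n\big|\mathbb{P}(D_1=s,\ D_2=t)-\mathbb{P}(\hat d_1=s,\ \hat d_2=t)\big|\to0,$$ and especially, as $n\to\infty$, $$\mathbb{P}(D_1=s,\ D_2=t)-\mathbb{P}(D_1=s)\,\mathbb{P}(D_2=t)\to0.$$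
   Context: Notation: $\mathbb{Z}_+=\{0,1,2,\dots\}$, $[n]=\{1,\dots,n\}$ (with $n\ge2$, so that nodes $1$ and $2$ exist); $\deg_G(i)$ is the number of nodes adjacent to $i$ in the graph $G$. The quantities $\hat d_1,\hat d_2$ depend on both $n$ and $M$. Model: For each $n$, let $m=m_n$ be the number of layers and $P^{(n)}$ a probability measure on $\{0,\dots,n\}\times[0,1]$. The triples $(G_{n,k},X_{n,k},Y_{n,k})$, $k=1,\dots,m$, are mutually independent, where $(X_{n,k},Y_{n,k})$ has distribution $P^{(n)}$ (size and strength of layer $k$, possibly dependent on each other) and $G_{n,k}$ is a random undirected graph with node set contained in $[n]$ such that: given $(X_{n,k},Y_{n,k})$, $V(G_{n,k})$ is uniformly distributed on the subsets of $[n]$ of size $X_{n,k}$; and given $(V(G_{n,k}),X_{n,k},Y_{n,k})$, each unordered node pair of $V(G_{n,k})$ is linked in $G_{n,k}$ with probability $Y_{n,k}$, independently of other pairs. The superposition graph $G_n$ has $V(G_n)=[n]$ and $E(G_n)=E(G_{n,1})\cup\cdots\cup E(G_{n,m})$. $P^{(n)}_{10}=\mathbb{E}(X_{n,k})$ and $P_{10}=\mathbb{E}(X)$ for $(X,Y)\sim P$. *)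

(* Defs.v *)
From HB Require Import structures.
From mathcomp Require Import all_boot all_order all_algebra.
From mathcomp Require Import all_classical all_reals all_analysis.
Import Order.TTheory GRing.Theory Num.Theory.
Import numFieldNormedType.Exports.

Set Implicit Arguments.
Unset Strict Implicit.
Unset Printing Implicit Defensive.

Local Open Scope classical_set_scope.
Local Open Scope ring_scope.

(* The node set [n] = {1, ..., n} is rendered by 'I_n, node i being the ordinal
   of value i - 1. *)

Definition node_pairs n (V : {set 'I_n}) : {set {set 'I_n}} :=
  [set e : {set 'I_n} | (e \subset V) && (#|e| == 2)].

(* Simple graphs with node set contained in [n]; a pair (node set, edge set). *)
Record graph n := Graph {
  graph_val : {set 'I_n} * {set {set 'I_n}} ;
  graph_valP : graph_val.2 \subset node_pairs graph_val.1 }.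

HB.instance Definition _ n := [isSub for @graph_val n].
HB.instance Definition _ n := [Finite of graph n by <:].

Definition nodes n (g : graph n) : {set 'I_n} := (graph_val g).1.
Definition edges n (g : graph n) : {set {set 'I_n}} := (graph_val g).2.

Definition degree n (g : graph n) (i : 'I_n) : nat :=
  #|[set j : 'I_n | [set i; j]%SET \in edges g]|.

Lemma superposition_subproof n (I : finType) (A : pred I) (g : I -> graph n) :
  (\bigcup_(k | A k) edges (g k))%SET \subset node_pairs [set: 'I_n].
Proof.
apply/bigcupsP => k _; apply: (fintype.subset_trans (graph_valP (g k))).
by apply/fintype.subsetP => e; rewrite !inE => /andP[_ ->]; rewrite finset.subsetT.
Qed.

(* The graph on all of [n] whose edges are those of the g k with A k. *)
Definition superposition n (I : finType) (A : pred I) (g : I -> graph n) :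
    graph n :=
  @Graph n ([set: 'I_n], \bigcup_(k | A k) edges (g k))%SET
    (superposition_subproof A g).

Definition empty_graph n : graph n :=
  @Graph n (finset.set0, finset.set0) (finset.sub0set _).

(* Graphs and node sets carry the discrete sigma-algebra. *)
HB.instance Definition _ n := isPointed.Build (graph n) (empty_graph n).
HB.instance Definition _ n := @isMeasurable.Build default_measure_display
  (graph n) discrete_measurable discrete_measurable0
  discrete_measurableC discrete_measurableU.

Definition nodeset n : Type := {set 'I_n}.
HB.instance Definition _ n := Finite.on (nodeset n).
HB.instance Definition _ n := isPointed.Build (nodeset n) finset.set0.
HB.instance Definition _ n := @isMeasurable.Build default_measure_display
  (nodeset n) discrete_measurable discrete_measurable0
  discrete_measurableC discrete_measurableU.

(* f (Z w) is a version of the conditional probability of A given Z. *)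
Definition cond_prob_given {d d'} {T : measurableType d}
    {T' : measurableType d'} {R : realType} (Pr : probability T R)
    (A : set T) (Z : T -> T') (f : T' -> R) : Prop :=
  measurable_fun setT f /\
  forall B : set T', measurable B ->
    Pr (A `&` Z @^-1` B) = (\int[Pr]_(w in Z @^-1` B) (f (Z w))%:E)%E.

(* Since some of the A k may be the whole space, the product rule for the full
   family contains the product rules for all subfamilies. *)
Definition mutually_independent {d d'} {T : measurableType d}
    {T' : measurableType d'} {R : realType} (Pr : probability T R)
    (I : finType) (W : I -> {RV Pr >-> T'}) : Prop :=
  forall A : I -> set T', (forall k, measurable (A k)) ->
    Pr (\bigcap_k (W k @^-1` A k)) = (\prod_k Pr (W k @^-1` A k))%E.

Definition weakly_cvg_on {R : realType} (D : set (nat * R))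
    (Q : nat -> probability (nat * R)%type R)
    (P : probability (nat * R)%type R) : Prop :=
  forall f : nat * R -> R,
    {within D, continuous f} ->
    (exists C : R, forall z, D z -> `|f z| <= C) ->
    (\int[Q n]_(z in D) (f z)%:E)%E @[n --> \oo]
      --> (\int[P]_(z in D) (f z)%:E)%E.

Definition mean_size {R : realType} (Q : probability (nat * R)%type R) : \bar R :=
  (\int[Q]_z (z.1%:R)%:E)%E.

(* Uniform law on the subsets of [n] of size z.1. *)
Definition uniform_subset_pmf {R : realType} n (V : {set 'I_n})
    (z : nat * R) : R :=
  if #|V| == z.1 then ('C(n, z.1)%:R)^-1 else 0.

(* Probability that E is the edge set when each node pair of V is linked
   independently of the others with probability y; z = (V, (x, y)). *)
Definition bernoulli_edges_pmf {R : realType} n (E : {set {set 'I_n}})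
    (z : nodeset n * (nat * R)) : R :=
  if E \subset node_pairs z.1 then
    \prod_(e in node_pairs z.1) (if e \in E then z.2.2 else 1 - z.2.2)
  else 0.

Section layers.
Context {d : measure_display} {T : measurableType d} {R : realType}.
Context (Pr : probability T R) (n m : nat).
Context (L : 'I_m -> {RV Pr >-> (graph n * (nat * R))%type}).

(* L k w is the triple (G_{n,k}, (X_{n,k}, Y_{n,k})) at the outcome w. *)
Definition layer_graph (k : 'I_m) (w : T) : graph n := (L k w).1.
Definition layer_size_strength (k : 'I_m) (w : T) : nat * R := (L k w).2.
Definition layer_size (k : 'I_m) (w : T) : nat := (L k w).2.1.

Record superposition_model (Q : probability (nat * R)%type R) : Prop := {
  model_support : Q ([set x | (x <= n)%N] `*` `[0, 1]) = 1%E ;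
  model_indep : mutually_independent L ;
  model_law : forall (k : 'I_m) (B : set (nat * R)), measurable B ->
    Pr (layer_size_strength k @^-1` B) = Q B ;
  model_nodes : forall (k : 'I_m) (V : {set 'I_n}),
    cond_prob_given Pr [set w | nodes (layer_graph k w) = V]
      (layer_size_strength k) (uniform_subset_pmf V) ;
  model_edges : forall (k : 'I_m) (E : {set {set 'I_n}}),
    cond_prob_given Pr [set w | edges (layer_graph k w) = E]
      (fun w => (nodes (layer_graph k w) : nodeset n, layer_size_strength k w))
      (bernoulli_edges_pmf E)
}.

(* D_{n,i} *)
Definition deg (i : 'I_n) (w : T) : nat :=
  degree (superposition xpredT (layer_graph^~ w)) i.

(* \hat d_i: only the layers of size at most M are superposed. *)
Definition deg_trunc (M : R) (i : 'I_n) (w : T) : nat :=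
  degree (superposition (fun k => (layer_size k w)%:R <= M)
            (layer_graph^~ w)) i.

End layers.

(* Nodes 1 and 2 exist when n >= 2, i.e. when n is of the form n'.+2. *)
Definition node1 n : 'I_n.+2 := ord0.
Definition node2 n : 'I_n.+2 := @Ordinal n.+2 1 isT.

(* Main.v *)
(* Let X be the size of a layer, so that a given node lies in the layer with
   conditional probability X/n and two given nodes lie in it with conditional
   probability at most (X/n)^2. A layer of size > M changes D_1 or D_2 only if it
   contains node 1 or 2, so a union bound gives the truncation error
   2 (m/n) E(X; X > M), which is small uniformly in n: weak convergence together
   with E X_n -> E X < oo makes the sizes uniformly integrable, and X_n <= n deals
   with the finitely many remaining n.

   The truncated degrees are functions of the neighbourhoods N_k(1), N_k(2) of
   the two nodes in the layers k. The pairs (N_k(1), N_k(2)) are independent in k,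
   and each of them is within total variation O(M^2/n^2) of the pair with the same
   marginals and independent components, because both components are nonempty
   with probability at most M^2/n^2. Summing over m = O(n) layers shows that the
   truncated degrees are asymptotically independent. *)

Require Import Defs.
From HB Require Import structures.
From mathcomp Require Import all_boot all_order all_algebra.
From mathcomp Require Import all_classical all_reals all_analysis.
From mathcomp Require Import measurable_realfun ring lra zify.
Import Order.TTheory GRing.Theory Num.Theory.
Import numFieldNormedType.Exports.

Set Implicit Arguments.
Unset Strict Implicit.
Unset Printing Implicit Defensive.

Local Open Scope classical_set_scope.
Local Open Scope ring_scope.

(** * Total variation distance between product laws *)

(** Telescoping: the factors of the first product are exchanged for those of the second one at a
    time, and term [k] records the exchange at position [k]. *)
Lemma normr_sub_prod_le (R : numDomainType) (m : nat) (a b : 'I_m -> R) :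
  (forall j, 0 <= a j) -> (forall j, 0 <= b j) ->
  `|\prod_j a j - \prod_j b j| <=
  \sum_(k < m) \prod_(j < m) (if (j < k)%N then a j else
                  if j == k then `|a j - b j| else b j).
Proof.
elim: m a b => [|m IHm] a b a0 b0; first by rewrite !big_ord0 subrr normr0.
rewrite !big_ord_recr /= ltnn eqxx.
set a' := a \o widen_ord (leqnSn m); set b' := b \o widen_ord (leqnSn m).
set A := \prod_j a' j; set B := \prod_j b' j.
(* The first summand goes to the induction hypothesis; the second is the telescoping term at the
   last index. *)
have -> : A * a ord_max - B * b ord_max =
    (A - B) * b ord_max + A * (a ord_max - b ord_max).
  by rewrite mulrBl mulrBr [RHS]addrC addrA subrK.
apply: (le_trans (ler_normD _ _)); apply: lerD.
  rewrite normrM (ger0_norm (b0 _)).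
  apply: (@le_trans _ _ ((\sum_(k < m) \prod_(j < m) (if (j < k)%N then a' j else
      if j == k then `|a' j - b' j| else b' j)) * b ord_max)).
    by apply: ler_wpM2r => //; apply: IHm => j; [exact: a0 | exact: b0].
  rewrite mulr_suml; apply: ler_sum => k _.
  rewrite big_ord_recr /= ltnNge ltnW ?ltn_ord //=.
  by rewrite -val_eqE /= gtn_eqF.
rewrite normrM ger0_norm; last by apply: prodr_ge0 => j _; exact: a0.
rewrite le_eqVlt; apply/orP; left; apply/eqP; congr (_ * _).
by apply: eq_bigr => j _; rewrite /= ltn_ord.
Qed.

Lemma sum_prod_ffun2 (R : comNzRingType) (I F G : finType) (c : I -> F -> G -> R) :
  \sum_(x : {ffun I -> F}) \sum_(y : {ffun I -> G}) \prod_i c i (x i) (y i) =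
  \prod_i \sum_a \sum_b c i a b.
Proof.
rewrite bigA_distr_bigA; apply: eq_bigr => x _.
by rewrite bigA_distr_bigA.
Qed.

(** Each telescoping term is a product over coordinates, so its sum over all families factorises.
    Every factor except the [k]-th is the total mass of a probability law, hence 1, and layer
    distances simply add up. *)
Lemma sum_normr_prod_le (R : numDomainType) (m : nat) (F G : finType)
    (u v : 'I_m -> F -> G -> R) :
  (forall k x y, 0 <= u k x y) -> (forall k x y, 0 <= v k x y) ->
  (forall k, \sum_x \sum_y u k x y = 1) ->
  (forall k, \sum_x \sum_y v k x y = 1) ->
  \sum_(x : {ffun 'I_m -> F}) \sum_(y : {ffun 'I_m -> G})
    `|\prod_k u k (x k) (y k) - \prod_k v k (x k) (y k)| <=
  \sum_k \sum_x \sum_y `|u k x y - v k x y|.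
Proof.
move=> u0 v0 u1 v1.
pose c (k j : 'I_m) x y := if (j < k)%N then u j x y else
  if j == k then `|u j x y - v j x y| else v j x y.
apply: (@le_trans _ _ (\sum_(k < m) \sum_(x : {ffun 'I_m -> F})
    \sum_(y : {ffun 'I_m -> G}) \prod_j c k j (x j) (y j))).
  rewrite [leRHS]exchange_big /=; apply: ler_sum => x _.
  rewrite [leRHS]exchange_big /=; apply: ler_sum => y _.
  exact: normr_sub_prod_le.
apply: ler_sum => k _; rewrite sum_prod_ffun2 (bigD1 k) //= [X in _ * X]big1 ?mulr1.
  by apply: ler_sum => x _; apply: ler_sum => y _; rewrite /c ltnn eqxx.
move=> j /negbTE jk; rewrite /c jk; case: ltnP => _; [exact: u1 | exact: v1].
Qed.

(** A vanishing total makes [u x0] the negative of the sum of the other values, so its modulus is at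
    most the mass off [x0]. *)
Lemma sum_normr_le_off (R : numDomainType) (F : finType) (x0 : F) (u : F -> R) :
  \sum_x u x = 0 -> \sum_x `|u x| <= 2 * \sum_(x | x != x0) `|u x|.
Proof.
move=> u0; rewrite (bigD1 x0) //= mulr_natl mulr2n; apply: lerD => //.
move/eqP: u0; rewrite (bigD1 x0) //= addr_eq0 => /eqP ->.
by rewrite normrN ler_norm_sum.
Qed.

(** The one-variable bound is applied first in [y], then in [x] after exchanging the sums; each use
    costs a factor 2. *)
Lemma sum2_normr_le_off (R : numDomainType) (F G : finType) (x0 : F) (y0 : G)
    (u : F -> G -> R) :
  (forall x, \sum_y u x y = 0) -> (forall y, \sum_x u x y = 0) ->
  \sum_x \sum_y `|u x y| <=
  4 * \sum_(x | x != x0) \sum_(y | y != y0) `|u x y|.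
Proof.
move=> hx hy.
apply: (@le_trans _ _ (\sum_x 2 * \sum_(y | y != y0) `|u x y|)).
  by apply: ler_sum => x _; exact: sum_normr_le_off.
have -> : 4 = 2 * 2 :> R by rewrite -natrM.
rewrite -mulr_sumr -mulrA ler_wpM2l // exchange_big [X in _ <= _ * X]exchange_big.
by rewrite mulr_sumr; apply: ler_sum => y _; exact: sum_normr_le_off.
Qed.

(** * Finite-valued functions of independent layers *)

Lemma measure_finite_partition d (T : measurableType d) (R : realType)
    (mu : {measure set T -> \bar R}) (F : finType) (X : T -> F) (A : set T) :
  (forall x, measurable (X @^-1` [set x])) -> measurable A ->
  mu A = (\sum_x mu (A `&` X @^-1` [set x]))%E.
Proof.
move=> mX mA.
rewrite [in LHS](_ : A = \bigcup_(x in [set: F]) (A `&` X @^-1` [set x])).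
  rewrite measure_fin_bigcup //.
  - rewrite (_ : [set: F] = [set` index_enum F]) -?fsbig_seq ?index_enum_uniq //.
    by apply/seteqP; split=> x //= _; exact: mem_index_enum.
  - exact: finite_finset.
  - by move=> x y _ _ [w [[_ <-] [_ <-]]].
  - by move=> x _; exact: measurableI.
apply/seteqP; split=> w; first by move=> Aw; exists (X w).
by case=> x _ [].
Qed.

Lemma fine_prob_sum d (T : measurableType d) (R : realType)
    (Pr : probability T R) (F : finType) (X : T -> F) (A : set T) :
  (forall x, measurable (X @^-1` [set x])) -> measurable A ->
  fine (Pr A) = \sum_x fine (Pr (A `&` X @^-1` [set x])).
Proof.
move=> mX mA; rewrite sum_fine -?measure_finite_partition // => x _.
by apply: fin_num_measure; exact: measurableI.
Qed.

Lemma prob_finite_partition d (T : measurableType d) (R : realType)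
    (Pr : probability T R) (F : finType) (X : T -> F) :
  (forall x, measurable (X @^-1` [set x])) ->
  \sum_x fine (Pr (X @^-1` [set x])) = 1.
Proof.
move=> mX; under eq_bigr do rewrite -[X @^-1` _]setTI.
by rewrite -fine_prob_sum // probability_setT.
Qed.

Lemma fine_prob_pred d (T : measurableType d) (R : realType)
    (Pr : probability T R) (F : finType) (X : T -> F) (c : pred F) :
  (forall x, measurable (X @^-1` [set x])) ->
  fine (Pr [set w | c (X w)]) = \sum_(x | c x) fine (Pr (X @^-1` [set x])).
Proof.
move=> mX; rewrite (@fine_prob_sum _ _ _ _ F X) //.
  rewrite [RHS]big_mkcond; apply: eq_bigr => x _; case: ifPn => cx.
    congr (fine (Pr _)); apply/seteqP; split=> w; first by case.
    by move=> /= Xw; split=> //=; rewrite Xw.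
  rewrite (_ : _ `&` _ = set0) ?measure0 //.
  by apply/seteqP; split=> w // -[/= cw Xw]; rewrite -Xw cw in cx.
rewrite (_ : [set w | _] = \bigcup_(x in [set x | c x]) X @^-1` [set x]).
  by apply: fin_bigcup_measurable => //; exact: finite_finset.
apply/seteqP; split=> w /=; first by exists (X w).
by case=> x + /= Xw; rewrite -Xw.
Qed.

Lemma preimage_pair_set1 (T F G : Type) (a : T -> F) (b : T -> G) (z : F * G) :
  (fun w => (a w, b w)) @^-1` [set z] = a @^-1` [set z.1] `&` b @^-1` [set z.2].
Proof. by case: z => x y; apply/seteqP; split=> w /= [-> ->]. Qed.

Lemma prob_ffun_eq d d' (T : measurableType d) (T' : measurableType d')
    (R : realType) (Pr : probability T R) (K F G : finType)
    (W : K -> {RV Pr >-> T'}) (a : T' -> F) (b : T' -> G)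
    (x : {ffun K -> F}) (y : {ffun K -> G}) :
  mutually_independent W ->
  (forall u, measurable (a @^-1` [set u])) ->
  (forall v, measurable (b @^-1` [set v])) ->
  fine (Pr ([set w | [ffun k => a (W k w)] = x] `&`
            [set w | [ffun k => b (W k w)] = y])) =
  \prod_k fine (Pr (W k @^-1` (a @^-1` [set x k] `&` b @^-1` [set y k]))).
Proof.
move=> indW ma mb.
pose A k := a @^-1` [set x k] `&` b @^-1` [set y k].
have mA k : measurable (A k) by exact: measurableI.
rewrite (_ : _ `&` _ = \bigcap_k (W k @^-1` A k)); last first.
  apply/seteqP; split=> [w [/= Xw Yw] k _|w /= xy].
    by rewrite /A -Xw -Yw /= !ffunE.
  by split; apply/ffunP => k; rewrite ffunE; case: (xy k I).
rewrite indW // -[RHS]/(fine (\prod_k fine (Pr (W k @^-1` A k)))%:E) -prodEFin.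
congr fine; apply: eq_bigr => k _; rewrite fineK //.
by apply: fin_num_measure; apply: measurable_funPTI; exact: mA.
Qed.

(* The difference of the law of (a W_k, b W_k) and of the product of its marginals
   has zero marginals, so its total variation is controlled by its values off the
   cross {x0} x G + F x {y0}. *)
Lemma indep_pair_prob_dist d d' (T : measurableType d) (T' : measurableType d')
    (R : realType) (Pr : probability T R) (m : nat) (F G : finType)
    (W : 'I_m -> {RV Pr >-> T'}) (a : T' -> F) (b : T' -> G) (x0 : F) (y0 : G)
    (f : pred {ffun 'I_m -> F}) (g : pred {ffun 'I_m -> G}) :
  mutually_independent W ->
  (forall u, measurable (a @^-1` [set u])) ->
  (forall v, measurable (b @^-1` [set v])) ->
  `| fine (Pr [set w | f [ffun k => a (W k w)] /\ g [ffun k => b (W k w)]])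
     - fine (Pr [set w | f [ffun k => a (W k w)]])
       * fine (Pr [set w | g [ffun k => b (W k w)]]) | <=
  \sum_k 4 * (fine (Pr [set w | a (W k w) != x0 /\ b (W k w) != y0])
     + fine (Pr [set w | a (W k w) != x0]) * fine (Pr [set w | b (W k w) != y0])).
Proof.
move=> indW ma mb.
pose X w : {ffun 'I_m -> F} := [ffun k => a (W k w)].
pose Y w : {ffun 'I_m -> G} := [ffun k => b (W k w)].
pose u k x y := fine (Pr (W k @^-1` (a @^-1` [set x] `&` b @^-1` [set y]))).
pose al k x := fine (Pr (W k @^-1` (a @^-1` [set x]))).
pose be k y := fine (Pr (W k @^-1` (b @^-1` [set y]))).
have mWa k x : measurable (W k @^-1` (a @^-1` [set x])).
  by apply: measurable_funPTI; exact: ma.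
have mWb k y : measurable (W k @^-1` (b @^-1` [set y])).
  by apply: measurable_funPTI; exact: mb.
have sum_u k x : \sum_y u k x y = al k x.
  by rewrite /al (@fine_prob_sum _ _ _ _ G (b \o W k) _ (mWb k)).
have sum_u' k y : \sum_x u k x y = be k y.
  rewrite /be (@fine_prob_sum _ _ _ _ F (a \o W k) _ (mWa k)) //.
  by apply: eq_bigr => x _; rewrite /u setIC.
have sum_al k : \sum_x al k x = 1.
  exact: (@prob_finite_partition _ _ _ _ F (a \o W k) (mWa k)).
have sum_be k : \sum_x be k x = 1.
  exact: (@prob_finite_partition _ _ _ _ G (b \o W k) (mWb k)).
have u0 k x y : 0 <= u k x y by exact: fine_ge0.
have al0 k x : 0 <= al k x by exact: fine_ge0.
have be0 k x : 0 <= be k x by exact: fine_ge0.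
have XYE x y : fine (Pr (X @^-1` [set x] `&` Y @^-1` [set y])) =
    \prod_k u k (x k) (y k) by exact: prob_ffun_eq.
have mX x : measurable (X @^-1` [set x]).
  rewrite (_ : _ @^-1` _ = \bigcap_k (W k @^-1` (a @^-1` [set x k]))).
    by apply: fin_bigcap_measurable => //; exact: finite_finset.
  apply/seteqP; split=> [w /= <- k _|w /= xy]; first by rewrite /= !ffunE.
  by apply/ffunP => k; rewrite ffunE; exact: xy.
have mY y : measurable (Y @^-1` [set y]).
  rewrite (_ : _ @^-1` _ = \bigcap_k (W k @^-1` (b @^-1` [set y k]))).
    by apply: fin_bigcap_measurable => //; exact: finite_finset.
  apply/seteqP; split=> [w /= <- k _|w /= xy]; first by rewrite /= !ffunE.
  by apply/ffunP => k; rewrite ffunE; exact: xy.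
(* The joint law is summed over all [y]; distributivity turns the sum of products into the product
   of the layer marginals. *)
have XE x : fine (Pr (X @^-1` [set x])) = \prod_k al k (x k).
  rewrite (@fine_prob_sum _ _ _ _ _ Y) //.
  rewrite (eq_bigr _ (fun y _ => XYE x y)).
  rewrite -(bigA_distr_bigA (fun k y => u k (x k) y)).
  by apply: eq_bigr => k _; exact: sum_u.
have YE y : fine (Pr (Y @^-1` [set y])) = \prod_k be k (y k).
  rewrite (@fine_prob_sum _ _ _ _ _ X) //.
  rewrite (eq_bigr (fun x : {ffun 'I_m -> F} => \prod_k u k (x k) (y k))); last first.
    by move=> x _; rewrite setIC XYE.
  rewrite -(bigA_distr_bigA (fun k x => u k x (y k))).
  by apply: eq_bigr => k _; exact: sum_u'.
have jointE : fine (Pr [set w | f (X w) /\ g (Y w)]) =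
    \sum_(x | f x) \sum_(y | g y) \prod_k u k (x k) (y k).
  pose XY w := (X w, Y w).
  have mXY z : measurable (XY @^-1` [set z]).
    by rewrite preimage_pair_set1; exact: measurableI.
  rewrite (_ : [set w | _] = [set w | (f (XY w).1 && g (XY w).2)]); last first.
    by apply/seteqP; split=> w /= /andP.
  rewrite (@fine_prob_pred _ _ _ _ _ XY (fun z => f z.1 && g z.2)) //.
  rewrite pair_big_dep /=; apply: eq_bigr => -[x y] _; rewrite -XYE.
  by rewrite preimage_pair_set1.
rewrite jointE (@fine_prob_pred _ _ _ _ _ X f) // (@fine_prob_pred _ _ _ _ _ Y g) //.
rewrite big_distrlr /= -sumrB.
(* Enlarging the sum from the pairs selected by [f] and [g] to all pairs gives the full l1 distance
   of the two laws, which no longer depends on [f] and [g]. *)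
apply: (@le_trans _ _ (\sum_(x : {ffun 'I_m -> F}) \sum_(y : {ffun 'I_m -> G})
    `|\prod_k u k (x k) (y k) - \prod_k (al k (x k) * be k (y k))|)).
  apply: le_trans (ler_norm_sum _ _ _) _.
  rewrite [leLHS]big_mkcond; apply: ler_sum => x _.
  case: ifP => _; last exact: sumr_ge0.
  rewrite -sumrB; apply: le_trans (ler_norm_sum _ _ _) _.
  rewrite [leLHS]big_mkcond; apply: ler_sum => y _; case: ifP => _ //.
  by rewrite XE YE big_split.
apply: (le_trans (@sum_normr_prod_le _ _ _ _ u (fun k x y => al k x * be k y)
  _ _ _ _)) => //.
- by move=> k x y; exact: mulr_ge0.
- by move=> k; rewrite -[RHS](sum_al k); apply: eq_bigr => x _.
- move=> k; under eq_bigr do rewrite -mulr_sumr sum_be mulr1.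
  exact: sum_al.
apply: ler_sum => k _.
apply: (le_trans (@sum2_normr_le_off _ _ _ x0 y0 _ _ _)).
- by move=> x; rewrite sumrB sum_u -mulr_sumr sum_be mulr1 subrr.
- by move=> y; rewrite sumrB sum_u' -mulr_suml sum_al mul1r subrr.
rewrite ler_wpM2l //.
apply: (@le_trans _ _ (\sum_(x | x != x0) \sum_(y | y != y0)
    (u k x y + al k x * be k y))).
  apply: ler_sum => x _; apply: ler_sum => y _.
  apply: le_trans (ler_normB _ _) _.
  by rewrite !ger0_norm //; exact: mulr_ge0.
under eq_bigr do rewrite big_split /=.
rewrite big_split /= -big_distrlr /=; apply: lerD.
  pose ab w := (a (W k w), b (W k w)).
  have mab z : measurable (ab @^-1` [set z]).
    by rewrite preimage_pair_set1; apply: measurableI; [exact: mWa|exact: mWb].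
  rewrite (_ : [set w | _ /\ _] =
      [set w | ((ab w).1 != x0) && ((ab w).2 != y0)]); last first.
    by apply/seteqP; split=> w /= /andP.
  rewrite (@fine_prob_pred _ _ _ _ _ ab (fun z => (z.1 != x0) && (z.2 != y0))) //.
  rewrite pair_big_dep /=; apply: ler_sum => -[x y] _.
  by rewrite preimage_pair_set1.
rewrite (@fine_prob_pred _ _ _ _ _ (a \o W k) (fun x => x != x0) (mWa k)) //.
by rewrite (@fine_prob_pred _ _ _ _ _ (b \o W k) (fun x => x != y0) (mWb k)).
Qed.

(** * Uniform random subsets containing a given set *)

(** The ratio ['C(n - k, x - k) / 'C(n, x)] is the product of the [(x - j) / (n - j)] for [j < k],
    and each of these is at most [x / n] because [x <= n]. The inequality is cross-multiplied to
    stay in the naturals. *)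
Lemma bin_sub_mul_expn_le (n x k : nat) : (k <= x <= n)%N ->
  ('C(n - k, x - k) * n ^ k <= 'C(n, x) * x ^ k)%N.
Proof.
elim: k => [|k IHk]; first by rewrite !subn0.
move=> /andP[kx xn]; have nk0 : (0 < n - k)%N by rewrite subn_gt0; lia.
apply: (@leq_trans ('C(n - k, x - k) * n ^ k * x)); last first.
  rewrite [X in (_ <= X)%N](_ : _ = 'C(n, x) * x ^ k * x)%N ?expnS; last lia.
  by rewrite leq_mul2r IHk ?orbT //; lia.
(* This is the single factor [(x - k) / (n - k) <= x / n]; multiplying by [n - k] brings it to the
   reach of [mul_bin_diag]. *)
suff : (n * 'C(n - k.+1, x - k.+1) <= x * 'C(n - k, x - k))%N.
  move=> h; rewrite expnS mulnCA mulnA -[X in (_ <= X)%N]mulnA.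
  by rewrite [(n ^ k * x)%N]mulnC mulnA [('C(n - k, _) * x)%N]mulnC leq_mul2r h orbT.
rewrite -(leq_pmul2l nk0).
have := mul_bin_diag (n - k) (x - k.+1).
rewrite -subnS (_ : (x - k.+1).+1 = x - k)%N; last lia.
move=> e; rewrite mulnCA e !mulnA leq_mul2r mulnBr mulnBl leq_sub2l ?orbT //.
by rewrite [X in (_ <= X)%N]mulnC leq_mul2l xn orbT.
Qed.

(** Removing [S] is injective on the supersets of [S] and sends those of size [x] to subsets of the
    complement of size [x - #|S|]. *)
Lemma card_supersets_le (T : finType) (S : {set T}) (x : nat) :
  (#|S| <= x)%N ->
  (#|[set V : {set T} | S \subset V & #|V| == x]| <=
   'C(#|T| - #|S|, x - #|S|))%N.
Proof.
move=> Sx; set A := [set V : {set T} | _ & _]%SET.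
have cC : (#|T| - #|S| = #|~: S|)%N by rewrite -(cardsC S) addKn.
rewrite cC -cards_draws.
have injA : {in A &, injective (fun V : {set T} => V :\: S)%SET}.
  move=> V W; rewrite !inE => /andP[SV _] /andP[SW _] VW.
  rewrite -(finset.setID V S) -(finset.setID W S) VW.
  by rewrite (finset.setIidPr SV) (finset.setIidPr SW).
rewrite -(card_in_imset injA); apply: subset_leq_card.
apply/fintype.subsetP => B /imsetP[V]; rewrite !inE => /andP[SV /eqP <-] ->.
by rewrite finset.setDE finset.subsetIr /= -finset.setDE cardsDS.
Qed.

(** The left side is the conditional probability that the node set of a layer contains [S]: a count
    of supersets divided by ['C(n, x)]. *)
Lemma sum_uniform_subset_pmf_le (R : realType) (n : nat) (S : {set 'I_n})
    (z : nat * R) :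
  \sum_(V : {set 'I_n} | S \subset V) uniform_subset_pmf V z <=
  (z.1%:R / n%:R) ^+ #|S|.
Proof.
set x := z.1.
have rhs0 : 0 <= (x%:R / n%:R) ^+ #|S| :> R by rewrite exprn_ge0 ?divr_ge0.
rewrite /uniform_subset_pmf -big_mkcondr /=.
rewrite sumr_const -/x.
rewrite (eq_card (B := [set V : {set 'I_n} | S \subset V & #|V| == x])); last first.
  by move=> V; rewrite [in RHS]inE.
set A := [set _ | _]%SET.
have [/andP[Sx xn]|] := boolP (#|S| <= x <= n)%N; last first.
  move=> h; rewrite (_ : A = finset.set0) ?cards0 //.
  apply/setP => V; rewrite !inE; apply/negP => /andP[SV /eqP Vx].
  move: h; rewrite -Vx subset_leq_card //=.
  by rewrite -[X in (_ <= X)%N](card_ord n) max_card.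
(* Division by [n] is meaningful only for [n > 0]. For [n = 0] the set [S] is empty and the right
   side is a zeroth power, equal to 1. *)
have [n0|n0] := posnP n.
  have x0 : x = 0%N by lia.
  have S0 : #|S| = 0%N by lia.
  have := card_supersets_le Sx; rewrite -/A card_ord S0 x0 subn0 !bin0 => A1.
  by rewrite expr0 invr1 (ler_nat R _ 1).
have C0 : 0 < 'C(n, x)%:R :> R by rewrite ltr0n bin_gt0.
rewrite -[leLHS]mulr_natl ler_pdivrMr // expr_div_n mulrAC.
rewrite ler_pdivlMr ?exprn_gt0 ?ltr0n //.
rewrite -!natrX -!natrM ler_nat.
rewrite [X in (_ <= X)%N]mulnC.
apply: leq_trans (bin_sub_mul_expn_le _); last by rewrite Sx.
rewrite leq_mul2r; apply/orP; right.
by have := card_supersets_le Sx; rewrite card_ord.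
Qed.

(** * Probability that a layer contains given nodes *)

Lemma measurable_layer_size_strength d (T : measurableType d) (R : realType)
    (Pr : probability T R) (n m : nat)
    (L : 'I_m -> {RV Pr >-> (graph n * (nat * R))%type}) (k : 'I_m) :
  measurable_fun setT (layer_size_strength L k).
Proof.
by apply: (@measurableT_comp _ _ _ _ _ _ snd) => //; exact: measurable_funPT.
Qed.

Lemma measurable_nodes_eq d (T : measurableType d) (R : realType)
    (Pr : probability T R) (n m : nat)
    (L : 'I_m -> {RV Pr >-> (graph n * (nat * R))%type}) (k : 'I_m)
    (V : {set 'I_n}) :
  measurable ((fun w => nodes (layer_graph L k w)) @^-1` [set V]).
Proof.
have mG : measurable_fun setT (layer_graph L k).
  by apply: (@measurableT_comp _ _ _ _ _ _ fst) => //; exact: measurable_funPT.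
by rewrite -[X in measurable X]setTI; exact: (mG measurableT [set g | nodes g = V]).
Qed.

Lemma measurable_size_fun (R : realType) (h : nat -> R) :
  measurable_fun setT (fun z : nat * R => h z.1).
Proof. exact: (@measurableT_comp _ _ _ _ _ _ h). Qed.

(** The event is split by the value [V] of the node set; each piece is an integral of the
    conditional uniform law, and the pointwise bound applies to their sum. The set [B] later
    restricts to small or to large layers. *)
Lemma prob_layer_superset_le d (T : measurableType d) (R : realType)
    (Pr : probability T R) (n m : nat)
    (L : 'I_m -> {RV Pr >-> (graph n * (nat * R))%type})
    (Q : probability (nat * R)%type R) (k : 'I_m) (S : {set 'I_n})
    (B : set (nat * R)) :
  superposition_model L Q -> measurable B ->
  (Pr [set w | S \subset nodes (layer_graph L k w) /\
               B (layer_size_strength L k w)] <=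
   \int[Q]_(z in B) ((z.1%:R / n%:R) ^+ #|S|)%:E)%E.
Proof.
move=> model mB.
pose Z := layer_size_strength L k; pose N w := nodes (layer_graph L k w).
have mZ : measurable_fun setT Z by exact: measurable_layer_size_strength.
have mN V : measurable (N @^-1` [set V]) by exact: measurable_nodes_eq.
have mZB : measurable (Z @^-1` B) by rewrite -[X in measurable X]setTI; exact: mZ.
have [mpmf pmfE] := all_and2 (model_nodes model k).
set A := [set w | _].
have AE V : A `&` N @^-1` [set V] =
    if S \subset V then [set w | N w = V] `&` Z @^-1` B else set0.
  apply/seteqP; split=> w; first by case=> -[SN BZ] /= NV; rewrite -NV SN.
  by case: ifP => // SV [NV BZ]; split=> //; split=> //; rewrite -/(N w) NV.
have mA : measurable A.
  rewrite (_ : A = \bigcup_V (A `&` N @^-1` [set V])).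
    apply: fin_bigcup_measurable; first exact: finite_finset.
    by move=> V _; rewrite AE; case: ifP => // _; exact: measurableI (mN V) mZB.
  by apply/seteqP; split=> w [] => [SN BZ|V _ []//]; exists (N w).
rewrite (measure_finite_partition Pr mN mA).
rewrite (eq_bigr (fun V : {set 'I_n} => if S \subset V then
    \int[Pr]_(w in Z @^-1` B) (uniform_subset_pmf V (Z w))%:E else 0))%E; last first.
  by move=> V _; rewrite AE; case: ifP => // _; exact: pmfE.
rewrite -big_mkcond /= -big_filter -ge0_integral_sum //; first last.
- by move=> V w _; rewrite lee_fin /uniform_subset_pmf; case: ifP.
- move=> V; apply/measurable_EFinP; apply: measurable_funTS.
  exact: (measurableT_comp (mpmf V) mZ).
have mf : measurable_fun setT (fun z : nat * R => (z.1%:R / n%:R : R) ^+ #|S|).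
  exact: (@measurable_size_fun R (fun x => (x%:R / n%:R) ^+ #|S|)).
apply: (@le_trans _ _ (\int[Pr]_(w in Z @^-1` B) (((Z w).1%:R / n%:R) ^+ #|S|)%:E)%E).
  apply: ge0_le_integral => //.
  - move=> w _; apply: sume_ge0 => V _.
    by rewrite lee_fin /uniform_subset_pmf; case: ifP.
  - apply: emeasurable_sum => V; apply/measurable_EFinP; apply: measurable_funTS.
    exact: (measurableT_comp (mpmf V) mZ).
  - apply/measurable_EFinP; apply: measurable_funTS.
    exact: (measurableT_comp mf mZ).
  - move=> w _; rewrite sumEFin lee_fin big_filter.
    exact: sum_uniform_subset_pmf_le.
have mfB : measurable_fun B (fun z : nat * R => ((z.1%:R / n%:R : R) ^+ #|S|)%:E).
  by apply/measurable_EFinP; apply: measurable_funTS.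
(* Change of variables from outcomes to the pair of size and strength, whose law is [Q]. *)
rewrite -(ge0_integral_pushforward mZ Pr mB mfB); last first.
  by move=> z _; rewrite lee_fin exprn_ge0 // divr_ge0.
rewrite le_eqVlt; apply/orP; left; apply/eqP; apply: eq_measure_integral => C mC _.
exact: (model_law model).
Qed.

(** * Uniform integrability of the layer sizes *)

(** The sizes form a discrete space, so even a sharply truncated size is a legitimate test function
    for weak convergence. *)
Lemma continuous_nat_fst (R : realType) (U : topologicalType) (h : nat -> U) :
  continuous (fun z : nat * R => h z.1).
Proof.
move=> z; apply: (@cvg_comp _ _ _ fst h _ (nbhs z.1)); first exact: cvg_fst.
by move=> A /nbhs_singleton hA; rewrite nbhs_principalE; exact/principal_filterP.
Qed.

(** Bridges weak convergence, stated with integrals over a set of full mass, and the expectations,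
    which are integrals over the whole space. *)
Lemma ge0_integral_prob1 d (T : measurableType d) (R : realType)
    (Q : probability T R) (D : set T) (f : T -> \bar R) :
  measurable D -> Q D = 1%E -> measurable_fun setT f -> (forall x, 0 <= f x)%E ->
  (\int[Q]_(x in D) f x = \int[Q]_x f x)%E.
Proof.
move=> mD QD mf f0.
have Q0 : Q (~` D) = 0%E by rewrite probability_setC // QD subee.
rewrite (@ge0_negligible_integral _ _ _ Q setT (~` D)) //.
- by rewrite setDE setCK setTI.
- exact: measurableC.
Qed.

Definition tail_size {R : realType} (Q : probability (nat * R)%type R) (M : R) :
    \bar R :=
  (\int[Q]_(z in [set z | (M < z.1%:R)%R]) (z.1%:R)%:E)%E.

Lemma measurable_size_set (R : realType) (A : set nat) :
  measurable [set z : nat * R | A z.1].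
Proof.
rewrite (_ : [set z | _] = A `*` setT); first exact: measurableX.
by apply/seteqP; split=> z // [].
Qed.

Lemma tail_size_le (R : realType) (Q : probability (nat * R)%type R) (M M' : R) :
  M <= M' -> (tail_size Q M' <= tail_size Q M)%E.
Proof.
move=> MM'; apply: ge0_subset_integral => //.
- exact: (@measurable_size_set R (fun x => M' < x%:R)).
- exact: (@measurable_size_set R (fun x => M < x%:R)).
- by apply/measurable_EFinP; apply: measurable_funTS; exact: measurable_size_fun.
- by move=> z; exact: le_lt_trans.
Qed.

(** Disposes of the finitely many [n] that an asymptotic bound misses: sizes above [M >= n] carry no
    mass. *)
Lemma tail_size_eq0 (R : realType) (n : nat) (Q : probability (nat * R)%type R)
    (M : R) :
  Q ([set x | (x <= n)%N] `*` `[0, 1]) = 1%E -> n%:R <= M -> tail_size Q M = 0%E.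
Proof.
move=> Qn nM; rewrite /tail_size.
have mS : measurable ([set x | (x <= n)%N] `*` `[0 : R, 1]) by exact: measurableX.
have Q0 : Q (~` ([set x | (x <= n)%N] `*` `[0, 1])) = 0%E.
  by rewrite probability_setC // Qn subee.
rewrite (@ge0_negligible_integral _ _ _ Q _ (~` ([set x | (x <= n)%N] `*` `[0, 1]))).
- rewrite setDE setCK (_ : _ `&` _ = set0) ?integral_set0 //.
  apply/seteqP; split=> z // -[/= Mz [/= zn _]].
  by have := lt_le_trans Mz (le_trans _ nM); rewrite ler_nat zn ltxx => /(_ isT).
- exact: measurableC.
- exact: (@measurable_size_set R (fun x => M < x%:R)).
- by apply/measurable_EFinP; apply: measurable_funTS; exact: measurable_size_fun.
- by [].
- exact: Q0.
Qed.

(** This is [E(X; X <= N)]. The cut-off sits in the integrand rather than in the domain, so that the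
    integrand is a bounded continuous test function. *)
Definition head_size {R : realType} (Q : probability (nat * R)%type R) (N : nat) :
    \bar R :=
  (\int[Q]_z ((if (z.1 <= N)%N then z.1%:R else 0 : R)%R)%:E)%E.

Lemma mean_size_split (R : realType) (Q : probability (nat * R)%type R) (N : nat) :
  mean_size Q = (head_size Q N + tail_size Q N%:R)%E.
Proof.
have mT : measurable [set z : nat * R | N%:R < z.1%:R :> R].
  exact: (@measurable_size_set R (fun x => N%:R < x%:R)).
have mx : measurable_fun setT (fun z : nat * R => (z.1%:R : R)%:E).
  by apply/measurable_EFinP; exact: measurable_size_fun.
rewrite /mean_size -(setvU [set z : nat * R | N%:R < z.1%:R :> R]).
rewrite (ge0_integral_setU _ (measurableC mT) mT) //=; first last.
- by apply/disj_set2P; rewrite setICl.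
- by rewrite setvU.
congr (_ + _)%E; rewrite /head_size [LHS]integral_mkcond.
apply: eq_integral => z _; rewrite patchE /=.
by rewrite in_setC; have [zN|zN] := leqP z.1 N;
  [rewrite memNset ?ifT //= ltr_nat ltnNge zN | rewrite mem_set //= ltr_nat].
Qed.

(** Monotone convergence: at each point the integrand increases with [N] and equals the size as soon
    as [N] reaches it. *)
Lemma head_size_cvg (R : realType) (Q : probability (nat * R)%type R) :
  head_size Q N @[N --> \oo] --> mean_size Q.
Proof.
have -> : mean_size Q = (\int[Q]_z limn (fun N =>
    (if (z.1 <= N)%N then z.1%:R else 0 : R)%:E))%E.
  apply: eq_integral => z _; apply/esym/cvg_lim => //.
  apply: cvg_near_cst; near=> N; rewrite ifT //.
  by near: N; exact: nbhs_infty_ge.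
apply: cvg_monotone_convergence => //.
- move=> N; apply/measurable_EFinP.
  exact: (@measurable_size_fun R (fun x => if (x <= N)%N then x%:R else 0)).
- by move=> N z _; rewrite lee_fin; case: ifP.
- move=> z _ a b ab; rewrite lee_fin; case: ifPn => za; last by case: ifP.
  by rewrite (leq_trans za).
Unshelve. all: by end_near. Qed.

Lemma head_size_fin (R : realType) (Q : probability (nat * R)%type R) (N : nat) :
  head_size Q N \is a fin_num.
Proof.
rewrite ge0_fin_numE; last by apply: integral_ge0 => z _; rewrite lee_fin; case: ifP.
apply: (@le_lt_trans _ _ (\int[Q]_z (N%:R)%:E)%E).
  apply: ge0_le_integral => //.
  - by move=> z _; rewrite lee_fin; case: ifP.
  - apply/measurable_EFinP.
    exact: (@measurable_size_fun R (fun x => if (x <= N)%N then x%:R else 0)).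
  - by move=> z _; rewrite lee_fin; case: ifP; rewrite ?ler_nat.
rewrite integral_cst // [X in (_ * X)%E](_ : _ = 1%E) ?mule1 ?ltry //.
exact: probability_setT.
Qed.

Lemma head_size_weak_cvg (R : realType) (Q : nat -> probability (nat * R)%type R)
    (P : probability (nat * R)%type R) (N : nat) :
  P (setT `*` `[0, 1]) = 1%E -> (\forall n \near \oo, Q n (setT `*` `[0, 1]) = 1%E) ->
  weakly_cvg_on (setT `*` `[0, 1]) Q P ->
  head_size (Q n) N @[n --> \oo] --> head_size P N.
Proof.
move=> P1 Q1 QP; pose h (x : nat) : R := if (x <= N)%N then x%:R else 0.
have mD : measurable ([set: nat] `*` `[0 : R, 1]) by exact: measurableX.
have hE (Q' : probability (nat * R)%type R) : Q' (setT `*` `[0, 1]) = 1%E ->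
    (\int[Q']_(z in setT `*` `[0%R, 1%R]) (h z.1)%:E)%E = head_size Q' N.
  move=> Q'1; apply: ge0_integral_prob1 => //.
    by apply/measurable_EFinP; exact: (@measurable_size_fun R h).
  by move=> z; rewrite lee_fin /h; case: ifP.
rewrite -hE //.
apply: cvg_trans (QP (fun z => h z.1) _ _); first last.
- exists N%:R => z _; rewrite /h ger0_norm; first by case: ifP; rewrite ?ler_nat.
  by case: ifP.
- by apply: continuous_subspaceT; exact: continuous_nat_fst.
by apply: near_eq_cvg; near=> n; rewrite hE //; near: n.
Unshelve. all: by end_near. Qed.

(** The tail is the mean minus the head. The mean converges by assumption and, for fixed [N], the
    head converges weakly; so the tails of [Q n] approach that of [P], which is small for large
    [N]. *)
Lemma tail_size_small (R : realType) (Q : nat -> probability (nat * R)%type R)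
    (P : probability (nat * R)%type R) (e : R) :
  P (setT `*` `[0, 1]) = 1%E -> (\forall n \near \oo, Q n (setT `*` `[0, 1]) = 1%E) ->
  weakly_cvg_on (setT `*` `[0, 1]) Q P ->
  mean_size (Q n) @[n --> \oo] --> mean_size P ->
  mean_size P \is a fin_num -> 0 < e ->
  exists N : nat, \forall n \near \oo, (tail_size (Q n) N%:R <= e%:E)%E.
Proof.
move=> P1 Q1 QP mQP mP e0.
have e20 : 0 < e / 2 by rewrite divr_gt0.
have e40 : 0 < e / 4 by rewrite divr_gt0.
have /fine_cvgP[_ hP] : head_size P N @[N --> \oo] --> (fine (mean_size P))%:E.
  by rewrite fineK //; exact: head_size_cvg.
move/cvgrPdist_lt/(_ _ e20): hP => [N _ /(_ N (leqnn N)) hN].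
exists N.
have /fine_cvgP[fmQ cmQ] : mean_size (Q n) @[n --> \oo] --> (fine (mean_size P))%:E.
  by rewrite fineK.
have /fine_cvgP[_ chQ] : head_size (Q n) N @[n --> \oo] --> (fine (head_size P N))%:E.
  by rewrite fineK ?head_size_fin //; exact: head_size_weak_cvg.
move/cvgrPdist_lt/(_ _ e40): cmQ => cmQ; move/cvgrPdist_lt/(_ _ e40): chQ => chQ.
near=> n.
have fmn : mean_size (Q n) \is a fin_num by near: n.
have hm : `|fine (mean_size P) - fine (mean_size (Q n))| < e / 4 by near: n.
have hh : `|fine (head_size P N) - fine (head_size (Q n) N)| < e / 4 by near: n.
have hfin := head_size_fin (Q n) N.
have := mean_size_split (Q n) N.
rewrite -(fineK fmn) -(fineK hfin) => /eqP; rewrite addeC -sube_eq //; last first.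
  by rewrite fin_num_adde_defl.
move=> /eqP <-; rewrite -EFinB lee_fin.
(* Error budget: [e / 4] for the means, [e / 4] for the heads and [e / 2] for the tail of [P]. *)
move: hm hh hN; rewrite /= !ltr_norml; lra.
Unshelve. all: by end_near. Qed.

(** * Degrees as functions of the layer neighbourhoods *)

(** A layer whose size is rejected by [A] is kept with an empty neighbourhood, so full and truncated
    degrees are unions over the same index set of functions of single layers. *)
Definition nbrs (R : realType) (n : nat) (A : pred nat) (i : 'I_n)
    (z : graph n * (nat * R)) : {set 'I_n} :=
  if A z.2.1 then [set j : 'I_n | [set i; j]%SET \in edges z.1]%SET
  else finset.set0.

(* D_i and \hat d_i are the instances at A = xpredT and A x = (x <= M). *)
Definition deg_sel d (T : measurableType d) (R : realType) (Pr : probability T R)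
    (n m : nat) (L : 'I_m -> {RV Pr >-> (graph n * (nat * R))%type})
    (A : pred nat) (i : 'I_n) (w : T) : nat :=
  degree (superposition (fun k => A (layer_size L k w)) ((layer_graph L)^~ w)) i.

Lemma deg_selE d (T : measurableType d) (R : realType) (Pr : probability T R)
    (n m : nat) (L : 'I_m -> {RV Pr >-> (graph n * (nat * R))%type})
    (A : pred nat) (i : 'I_n) (w : T) :
  deg_sel L A i w = #|\bigcup_k nbrs A i (L k w)|%SET.
Proof.
rewrite /deg_sel /degree; apply: eq_card => j; apply/idP/idP.
  move=> /asboolP/bigcupP[k Ak ijk]; apply/bigcupP; exists k => //.
  by rewrite /nbrs ifT // inE.
move=> /bigcupP[k _]; rewrite /nbrs; case: ifP => [Ak|_]; rewrite inE // => ijk.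
by apply/asboolP/bigcupP; exists k.
Qed.

Lemma nbrs_neq0 (R : realType) (n : nat) (A : pred nat) (i : 'I_n)
    (z : graph n * (nat * R)) :
  nbrs A i z != finset.set0 -> i \in nodes z.1 /\ A z.2.1.
Proof.
rewrite /nbrs; case: ifP => [Az|]; last by rewrite eqxx.
case/set0Pn => j; rewrite inE => ij; split=> //.
have := fintype.subsetP (graph_valP z.1) _ ij; rewrite inE => /andP[+ _].
by move/fintype.subsetP; apply; rewrite !inE eqxx.
Qed.

(** There are finitely many graphs and all sets of sizes are measurable, so the set is a finite
    union of measurable rectangles. *)
Lemma measurable_graph_size_set (R : realType) (n : nat) (C : graph n -> nat -> Prop) :
  measurable [set z : graph n * (nat * R) | C z.1 z.2.1].
Proof.
rewrite (_ : [set z | _] = \bigcup_g ([set g] `*` [set z : nat * R | C g z.1])).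
  apply: fin_bigcup_measurable; first exact: finite_finset.
  by move=> g _; apply: measurableX => //; exact: measurable_size_set.
apply/seteqP; split=> z /=; first by exists z.1.
by case=> g _ [/= -> ].
Qed.

Lemma measurable_layer_event d (T : measurableType d) (R : realType)
    (Pr : probability T R) (n m : nat)
    (L : 'I_m -> {RV Pr >-> (graph n * (nat * R))%type}) (k : 'I_m)
    (C : graph n -> nat -> Prop) :
  measurable [set w | C (layer_graph L k w) (layer_size L k w)].
Proof.
exact: (measurable_funPTI (L k) (@measurable_graph_size_set R n C)).
Qed.

Lemma measurable_nbrs (R : realType) (n : nat) (A : pred nat) (i : 'I_n)
    (u : {set 'I_n}) :
  measurable (@nbrs R n A i @^-1` [set u]).
Proof.
exact: (@measurable_graph_size_set R n (fun g x =>
  (if A x then [set j : 'I_n | [set i; j]%SET \in edges g]%SET else finset.set0) = u)).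
Qed.

Lemma measurable_deg_sel d (T : measurableType d) (R : realType)
    (Pr : probability T R) (n m : nat)
    (L : 'I_m -> {RV Pr >-> (graph n * (nat * R))%type}) (A : pred nat)
    (i : 'I_n) (B : set nat) :
  measurable [set w | B (deg_sel L A i w)].
Proof.
pose X w : {ffun 'I_m -> {set 'I_n}} := [ffun k => nbrs A i (L k w)].
rewrite (_ : [set w | _] =
    \bigcup_(x in [set x : {ffun 'I_m -> {set 'I_n}} | B #|\bigcup_k x k|%SET])
    \bigcap_k (L k @^-1` (nbrs A i @^-1` [set x k]))).
  apply: fin_bigcup_measurable => [|x _]; first exact: finite_finset.
  apply: fin_bigcap_measurable => [|k _]; first exact: finite_finset.
  exact: (measurable_funPTI (L k) (measurable_nbrs _ _ _)).
apply/seteqP; split=> w /=.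
  rewrite deg_selE => Bw; exists (X w); last by move=> k _ /=; rewrite ffunE.
  by rewrite /=; under eq_bigr do rewrite ffunE.
case=> x /= Bx xE; rewrite deg_selE (eq_bigr x) // => k _.
exact: xE.
Qed.

(** * Near independence of the truncated degrees *)

Lemma prob_small_layer_superset_le d (T : measurableType d) (R : realType)
    (Pr : probability T R) (n m : nat)
    (L : 'I_m -> {RV Pr >-> (graph n * (nat * R))%type})
    (Q : probability (nat * R)%type R) (k : 'I_m) (S : {set 'I_n}) (M : R) :
  superposition_model L Q -> 0 <= M ->
  fine (Pr [set w | S \subset nodes (layer_graph L k w) /\
                    (layer_size L k w)%:R <= M]) <= (M / n%:R) ^+ #|S|.
Proof.
move=> model M0.
have mB : measurable [set z : nat * R | z.1%:R <= M].
  exact: (@measurable_size_set R (fun x => x%:R <= M)).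
have := prob_layer_superset_le k S model mB.
set p := Pr _ => hp; rewrite -lee_fin fineK; last first.
  apply: fin_num_measure.
  exact: (measurable_layer_event L k (fun g x => S \subset nodes g /\ x%:R <= M)).
apply: (le_trans hp).
apply: (@le_trans _ _ (\int[Q]_(z in [set z : nat * R | (z.1%:R <= M)%R])
    ((M / n%:R) ^+ #|S|)%:E)%E).
  apply: ge0_le_integral => //.
  - apply/measurable_EFinP; apply: measurable_funTS.
    exact: (@measurable_size_fun R (fun x => (x%:R / n%:R) ^+ #|S|)).
  - move=> z zM; rewrite lee_fin lerXn2r ?nnegrE ?divr_ge0 //.
    by rewrite ler_wpM2r // invr_ge0.
rewrite integral_cst //.
rewrite -[leRHS]mule1 lee_wpmul2l ?lee_fin ?exprn_ge0 ?divr_ge0 //.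
exact: probability_le1.
Qed.

(** The total variation bound is used with the empty neighbourhood as both base points. A nonempty
    neighbourhood of a node forces the node into a layer of size at most [M]. *)
Lemma deg_trunc_near_indep d (T : measurableType d) (R : realType)
    (Pr : probability T R) (n m : nat)
    (L : 'I_m -> {RV Pr >-> (graph n * (nat * R))%type})
    (Q : probability (nat * R)%type R) (i j : 'I_n) (M : R) (s t : nat) :
  superposition_model L Q -> 0 <= M -> i != j ->
  `| fine (Pr [set w | deg_trunc L M i w = s /\ deg_trunc L M j w = t])
     - fine (Pr [set w | deg_trunc L M i w = s])
       * fine (Pr [set w | deg_trunc L M j w = t]) | <=
  8 * m%:R * (M / n%:R) ^+ 2.
Proof.
move=> model M0 ij; pose A (x : nat) := x%:R <= M.
pose f s := [pred x : {ffun 'I_m -> {set 'I_n}} | #|\bigcup_k x k|%SET == s].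
have fE u v w : f u [ffun k => nbrs A v (L k w)] <-> deg_trunc L M v w = u.
  rewrite [deg_trunc _ _ _ _](deg_selE L A v w) /=.
  by under eq_bigr do rewrite ffunE; split => /eqP.
have := @indep_pair_prob_dist _ _ _ _ _ _ _ _ _ L (nbrs A i) (nbrs A j)
  finset.set0 finset.set0 (f s) (f t) (model_indep model)
  (measurable_nbrs A i) (measurable_nbrs A j).
rewrite (_ : [set w | f s _] = [set w | deg_trunc L M i w = s]); last first.
  by apply/seteqP; split=> w /fE.
rewrite (_ : [set w | f t _] = [set w | deg_trunc L M j w = t]); last first.
  by apply/seteqP; split=> w /fE.
rewrite (_ : [set w | f s _ /\ _] =
   [set w | deg_trunc L M i w = s /\ deg_trunc L M j w = t]); last first.
  by apply/seteqP; split=> w [/fE ? /fE ?].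
move=> h; apply: (le_trans h).
(* Per layer: 4 from the two-variable bound, times one [(M / n) ^+ 2] for both nodes in the layer
   and another for the product of the two single probabilities. *)
have -> : 8 * m%:R * (M / n%:R) ^+ 2 =
    \sum_(k < m) 4 * ((M / n%:R) ^+ 2 + M / n%:R * (M / n%:R)).
  rewrite sumr_const card_ord -mulr_natr; ring.
apply: ler_sum => k _; rewrite ler_wpM2l //.
have le_prob (C C' : graph n -> nat -> Prop) : (forall g x, C g x -> C' g x) ->
    fine (Pr [set w | C (layer_graph L k w) (layer_size L k w)]) <=
    fine (Pr [set w | C' (layer_graph L k w) (layer_size L k w)]).
  move=> CC'.
  have mC := measurable_layer_event L k C; have mC' := measurable_layer_event L k C'.
  rewrite fine_le ?fin_num_measure //; apply: le_measure; rewrite ?inE //.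
  by move=> w; exact: CC'.
pose N v g x := (if A x then [set j : 'I_n | [set v; j]%SET \in edges g]%SET
  else finset.set0) != finset.set0.
have single v : fine (Pr [set w | nbrs A v (L k w) != finset.set0]) <= M / n%:R.
  rewrite -[leRHS]expr1 -(cards1 v).
  apply: le_trans (prob_small_layer_superset_le k [set v]%SET model M0).
  apply: (le_prob (N v) (fun g x => [set v]%SET \subset nodes g /\ x%:R <= M)) => g x.
  (* The strength 0 is a placeholder: [nbrs] reads only the graph and the size. *)
  by move=> /(@nbrs_neq0 R n A v (g, (x, 0))) [vg Ax]; rewrite finset.sub1set.
apply: lerD; last first.
  by apply: ler_pM => //; exact: fine_ge0.
have c2 : #|[set i; j]%SET| = 2%N by rewrite cards2 ij.
rewrite -[X in _ ^+ X]c2.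
apply: le_trans (prob_small_layer_superset_le k [set i; j]%SET model M0).
apply: (le_prob (fun g x => N i g x /\ N j g x)
  (fun g x => [set i; j]%SET \subset nodes g /\ x%:R <= M)) => g x.
case=> /(@nbrs_neq0 R n A i (g, (x, 0))) [ig Ax].
move=> /(@nbrs_neq0 R n A j (g, (x, 0))) [jg _]; split=> //.
by apply/fintype.subsetP => v; rewrite !inE => /orP[/eqP->|/eqP->].
Qed.

(** * The truncation error *)

Lemma prob_bigsetU_le d (T : measurableType d) (R : realType)
    (Pr : probability T R) (I : Type) (r : seq I) (F : I -> set T) :
  (forall k, measurable (F k)) ->
  (Pr (\big[setU/set0]_(k <- r) F k) <= \sum_(k <- r) Pr (F k))%E.
Proof.
move=> mF; elim: r => [|k r IHr]; first by rewrite !big_nil measure0.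
rewrite !big_cons; apply: le_trans (leeD2l _ IHr).
by apply: measureU2 => //; exact: bigsetU_measurable.
Qed.

Lemma fine_prob_dist_le d (T : measurableType d) (R : realType)
    (Pr : probability T R) (A B C : set T) :
  measurable A -> measurable B -> measurable C ->
  (forall w, ~ C w -> A w <-> B w) ->
  `|fine (Pr A) - fine (Pr B)| <= fine (Pr C).
Proof.
move=> mA mB mC AB.
have le_dist (D E : set T) : measurable D -> measurable E -> D `<=` E `|` C ->
    fine (Pr D) <= fine (Pr E) + fine (Pr C).
  move=> mD mE DEC; rewrite -fineD ?fin_num_measure // fine_le ?fin_num_measure //.
    by rewrite fin_numD !fin_num_measure.
  apply: (@le_trans _ _ (Pr (E `|` C))); last exact: measureU2.
  by apply: le_measure; rewrite ?inE //; exact: measurableU.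
have AC : A `<=` B `|` C.
  by move=> w Aw; have [Cw|Cw] := pselect (C w); [right | left; apply/(AB w Cw)].
have BC : B `<=` A `|` C.
  by move=> w Bw; have [Cw|Cw] := pselect (C w); [right | left; apply/(AB w Cw)].
have := le_dist _ _ mA mB AC; have := le_dist _ _ mB mA BC.
by rewrite ler_norml; lra.
Qed.

(** Splitting by the countably many values of the first degree reduces to events about one degree.
    An arbitrary relation [c] covers joint and marginal events alike. *)
Lemma measurable_deg_pair d (T : measurableType d) (R : realType)
    (Pr : probability T R) (n m : nat)
    (L : 'I_m -> {RV Pr >-> (graph n * (nat * R))%type}) (A : pred nat)
    (i j : 'I_n) (c : nat -> nat -> Prop) :
  measurable [set w | c (deg_sel L A i w) (deg_sel L A j w)].
Proof.
rewrite (_ : [set w | _] = \bigcup_s ([set w | deg_sel L A i w = s] `&`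
    [set w | c s (deg_sel L A j w)])).
  apply: bigcup_measurable => s _; apply: measurableI.
    exact: (measurable_deg_sel L A i (fun x => x = s)).
  exact: (measurable_deg_sel L A j (c s)).
by apply/seteqP; split=> w /= => [?|[s _ [<-]]//]; exists (deg_sel L A i w).
Qed.

(** Off the event that some layer of size above [M] contains [i] or [j], both degrees are unchanged.
    Each of the [2 * m] pairs of a node and a layer costs at most [c / n]. *)
Lemma deg_trunc_dist_le d (T : measurableType d) (R : realType)
    (Pr : probability T R) (n m : nat)
    (L : 'I_m -> {RV Pr >-> (graph n * (nat * R))%type})
    (Q : probability (nat * R)%type R) (i j : 'I_n) (M c : R)
    (C : nat -> nat -> Prop) :
  superposition_model L Q -> (tail_size Q M <= c%:E)%E ->
  `| fine (Pr [set w | C (deg L i w) (deg L j w)])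
     - fine (Pr [set w | C (deg_trunc L M i w) (deg_trunc L M j w)]) | <=
  2 * (m%:R / n%:R) * c.
Proof.
move=> model tailc.
pose bad v k := [set w | v \in nodes (layer_graph L k w) /\ M < (layer_size L k w)%:R].
have mbad v k : measurable (bad v k).
  exact: (measurable_layer_event L k (fun g x => v \in nodes g /\ M < x%:R)).
pose B := \big[setU/set0]_(k < m) (bad i k `|` bad j k).
have mB : measurable B by apply: bigsetU_measurable => k _; exact: measurableU.
have PrB : (Pr B <= (2 * (m%:R / n%:R) * c)%:E)%E.
  apply: le_trans (prob_bigsetU_le _ _ _) _; first by move=> k; exact: measurableU.
  rewrite (_ : 2 * _ * c = \sum_(k < m) (c / n%:R + c / n%:R)); last first.
    by rewrite sumr_const card_ord -mulr_natr; ring.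
  rewrite -sumEFin; apply: lee_sum => k _.
  have bad1 v : (Pr (bad v k) <= (c / n%:R)%:E)%E.
    have mt : measurable [set z : nat * R | M < z.1%:R].
      exact: (@measurable_size_set R (fun x => M < x%:R)).
    have := prob_layer_superset_le k [set v]%SET model mt.
    rewrite cards1 (_ : [set w | _] = bad v k); last first.
      by apply/seteqP; split=> w /= []; rewrite finset.sub1set.
    move=> h; apply: (le_trans h).
    under eq_integral do rewrite expr1 mulrC EFinM.
    rewrite ge0_integralZl //; first last.
    - by apply/measurable_EFinP; apply: measurable_funTS; exact: measurable_size_fun.
    by rewrite mulrC EFinM lee_wpmul2l // lee_fin invr_ge0.
  apply: (le_trans (measureU2 _ (mbad i k) (mbad j k))).
  by rewrite EFinD; exact: leeD (bad1 i) (bad1 j).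
have agree w v : (v == i) || (v == j) -> ~ B w -> deg L v w = deg_trunc L M v w.
  move=> vij nB.
  rewrite [LHS](deg_selE L xpredT) [RHS](deg_selE L (fun x => x%:R <= M)).
  congr (#|pred_of_set _|); apply: eq_bigr => k _.
  rewrite {2}/nbrs; case: ifPn => //; rewrite -ltNge => Mk.
  (* A discarded layer in which [v] had a neighbour would contain [v] and have size above [M], hence
     belong to [B]. *)
  apply/eqP; apply: contra_notT nB => /nbrs_neq0[vk _].
  rewrite /B -bigcup_seq; exists k; rewrite /= ?mem_index_enum //.
  by case/orP: vij => /eqP <-; [left | right].
rewrite -lee_fin; apply: le_trans PrB.
rewrite -[leRHS]fineK ?fin_num_measure // lee_fin.
apply: fine_prob_dist_le => //.
- exact: (measurable_deg_pair L xpredT).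
- exact: (measurable_deg_pair L (fun x => x%:R <= M)).
- by move=> w Bw /=; rewrite !agree ?eqxx ?orbT.
Qed.

(** Uniform integrability handles large [n] and bounded support the others. The relation [C] is
    quantified after [M], so one threshold serves the joint event and both marginals. *)
Lemma truncation_error_uniform (R : realType) (mu : R) (m : nat -> nat)
  (d : nat -> measure_display) (T : forall n : nat, measurableType (d n))
  (Pr : forall n : nat, probability (T n) R)
  (L : forall n : nat, 'I_(m n) -> {RV (Pr n) >-> (graph n * (nat * R))%type})
  (Q : nat -> probability (nat * R)%type R)
  (P : probability (nat * R)%type R) (e : R) :
  (forall n : nat, (2 <= n)%N -> superposition_model (L n) (Q n)) ->
  ((m n)%:R / n%:R : R) @[n --> \oo] --> mu ->
  P (setT `*` `[0, 1]) = 1%E ->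
  weakly_cvg_on (setT `*` `[0, 1]) Q P ->
  mean_size (Q n) @[n --> \oo] --> mean_size P ->
  mean_size P \is a fin_num -> 0 < mu -> 0 < e ->
  \forall M \near +oo, forall n, (2 <= n)%N ->
    forall (i j : 'I_n) (C : nat -> nat -> Prop),
    `| fine (Pr n [set w | C (deg (@L n) i w) (deg (@L n) j w)])
       - fine (Pr n [set w | C (deg_trunc (@L n) M i w) (deg_trunc (@L n) M j w)]) |
    <= e.
Proof.
move=> model hmn P1 hweak hmean mP mu0 e0.
pose K := mu + 1; have K0 : 0 < K by rewrite addr_gt0.
(* Chosen so that [2 * K * e' = e], where [K] eventually bounds [m n / n]. *)
pose e' := e / (2 * K); have e'0 : 0 < e' by rewrite divr_gt0 // mulr_gt0.
have Q1 : \forall n \near \oo, Q n (setT `*` `[0, 1]) = 1%E.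
  near=> n; apply/eqP; rewrite eq_le probability_le1 /=; last exact: measurableX.
  rewrite -(model_support (model n _)); last by near: n; exact: nbhs_infty_ge.
  apply: le_measure; rewrite ?inE; [exact: measurableX | exact: measurableX |].
  by move=> z [].
have [N hN] := tail_size_small P1 Q1 hweak hmean mP e'0.
have hK : \forall n \near \oo, (m n)%:R / n%:R <= K.
  move/cvgrPdist_lt/(_ _ ltr01): hmn; apply: filterS => n /=.
  by rewrite /K ltr_norml; lra.
have [n0 _ hn0] := filterI hN hK.
near=> M => n n2 i j C.
have [n0n|nn0] := leqP n0 n.
  have [tn Kn] := hn0 _ n0n.
  have NM : N%:R <= M by near: M; exact: nbhs_pinfty_ge.
  have tM := le_trans (tail_size_le (Q n) NM) tn.
  apply: (le_trans (deg_trunc_dist_le i j C (model n n2) tM)).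
  apply: (@le_trans _ _ (2 * K * e')); last first.
    by rewrite /e' mulrC divfK // mulf_neq0 ?gt_eqF.
  by rewrite ler_wpM2r ?ler_wpM2l // ltW.
(* For [n < n0], taking [M >= n0] makes the tail vanish exactly. *)
have tn : (tail_size (Q n) M <= 0%:E)%E.
  rewrite (tail_size_eq0 (model_support (model n n2))) //.
  apply: (@le_trans _ _ n0%:R); first by rewrite ler_nat ltnW.
  by near: M; exact: nbhs_pinfty_ge.
apply: (le_trans (deg_trunc_dist_le i j C (model n n2) tn)).
by rewrite mulr0 ltW.
Unshelve. all: by end_near. Qed.

(** * Both limits from the truncation and independence bounds *)

Theorem lemma3 (R : realType) (mu : R) (m : nat -> nat)
  (d : nat -> measure_display) (T : forall n : nat, measurableType (d n))
  (Pr : forall n : nat, probability (T n) R)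
  (L : forall n : nat, 'I_(m n) -> {RV (Pr n) >-> (graph n * (nat * R))%type})
  (Q : nat -> probability (nat * R)%type R)
  (P : probability (nat * R)%type R)
  (hmodel : forall n : nat, (2 <= n)%N -> superposition_model (L n) (Q n))
  (hmu : 0 < mu)
  (hm : m n @[n --> \oo] --> \oo)
  (hmn : ((m n)%:R / n%:R : R) @[n --> \oo] --> mu)
  (hP : P (setT `*` `[0, 1]) = 1%E)
  (hweak : weakly_cvg_on (setT `*` `[0, 1]) Q P)
  (hmean : mean_size (Q n) @[n --> \oo] --> mean_size P)
  (hP10 : (0 < mean_size P < +oo)%E)
  (s t : nat) :
  (ereal_sup (range (fun n : nat =>
     `| Pr n.+2 [set w | deg (L n.+2) (node1 n) w = s /\
                         deg (L n.+2) (node2 n) w = t]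
      - Pr n.+2 [set w | deg_trunc (L n.+2) M (node1 n) w = s /\
                         deg_trunc (L n.+2) M (node2 n) w = t] |%E))
     @[M --> +oo%R] --> 0%E)
  /\
  ((Pr n.+2 [set w | deg (L n.+2) (node1 n) w = s /\
                     deg (L n.+2) (node2 n) w = t]
    - Pr n.+2 [set w | deg (L n.+2) (node1 n) w = s]
      * Pr n.+2 [set w | deg (L n.+2) (node2 n) w = t])%E
     @[n --> \oo] --> 0%E).
Proof.
have mP : mean_size P \is a fin_num.
  by case/andP: hP10 => P0 P1; rewrite ge0_fin_numE // ltW.
have trunc (e : R) (e0 : 0 < e) :=
  truncation_error_uniform hmodel hmn hP hweak hmean mP hmu e0.
have finD n (A : pred nat) (i j : 'I_n) (C : nat -> nat -> Prop) :
    Pr n [set w | C (deg_sel (L n) A i w) (deg_sel (L n) A j w)] \is a fin_num.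
  by apply: fin_num_measure; exact: measurable_deg_pair.
split.
  have sup_le (e : R) : 0 < e -> \forall M \near +oo%R,
      (0 <= ereal_sup (range (fun n : nat =>
     `| Pr n.+2 [set w | deg (L n.+2) (node1 n) w = s /\
                         deg (L n.+2) (node2 n) w = t]
      - Pr n.+2 [set w | deg_trunc (L n.+2) M (node1 n) w = s /\
                         deg_trunc (L n.+2) M (node2 n) w = t] |)) <= e%:E)%E.
    move=> e0; apply: filterS (trunc e e0) => M hM; apply/andP; split.
      (* The supremum dominates its member at index 0, an absolute value. *)
      apply: le_trans (ereal_sup_ubound (ex_intro2 _ _ 0%N I erefl)).
      exact: abse_ge0.
    apply: ge_ereal_sup => _ [n _ <-].
    have := hM n.+2 isT (node1 n) (node2 n) (fun a b => a = s /\ b = t).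
    rewrite -lee_fin; apply: le_trans.
    rewrite -[in leLHS](fineK (finD n.+2 xpredT _ _ (fun a b => a = s /\ b = t))).
    by rewrite -[in leLHS](fineK (finD n.+2 (fun x => x%:R <= M) _ _
      (fun a b => a = s /\ b = t))).
  apply/fine_cvgP; split.
    apply: filterS (sup_le 1 ltr01) => M /andP[s0 s1].
    by rewrite ge0_fin_numE // (le_lt_trans s1) // ltry.
  apply/cvgrPdist_le => e e0; apply: filterS (sup_le e e0) => M /andP[s0 se] /=.
  rewrite sub0r normrN ger0_norm ?fine_ge0 // -lee_fin fineK // ge0_fin_numE //.
  by rewrite (le_lt_trans se) // ltry.
pose p n (A : pred nat) (C : nat -> nat -> Prop) := fine (Pr n.+2
  [set w | C (deg_sel (L n.+2) A (node1 n) w) (deg_sel (L n.+2) A (node2 n) w)]).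
pose C12 a b := a = s /\ b = t.
pose C1 (a b : nat) := a = s; pose C2 (a b : nat) := b = t.
suff : (fun n => p n xpredT C12 - p n xpredT C1 * p n xpredT C2) @ \oo --> (0 : R).
  move=> pcvg.
  have f12 n := finD n.+2 xpredT (node1 n) (node2 n) C12.
  have f1 n := finD n.+2 xpredT (node1 n) (node2 n) C1.
  have f2 n := finD n.+2 xpredT (node1 n) (node2 n) C2.
  apply/fine_cvgP; split.
    near=> n; rewrite fin_numB; apply/andP; split; first exact: f12.
    exact: fin_numM (f1 n) (f2 n).
  apply: cvg_trans pcvg; apply: near_eq_cvg; near=> n.
  rewrite /= fineB ?fineM //.
  exact: fin_numM (f1 n) (f2 n).
apply/cvgrPdist_le => e e0.
(* Four errors: truncating the joint event, near independence after truncation, and truncating each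
   of the two marginals. *)
have e40 : 0 < e / 4 by rewrite divr_gt0.
have [n0 _ hn0] : \forall n \near \oo, (m n)%:R / n%:R <= mu + 1.
  by move/cvgrPdist_lt/(_ _ ltr01): hmn; apply: filterS => n /=; rewrite ltr_norml; lra.
(* [M] is fixed before [n] grows: the independence error contains [M ^+ 2 / n]. *)
near (pinfty_nbhs R) => M.
have M0 : 0 <= M by near: M; exact: nbhs_pinfty_ge.
have hM : forall n, (2 <= n)%N -> forall (i j : 'I_n) (C : nat -> nat -> Prop),
    `| fine (Pr n [set w | C (deg (L n) i w) (deg (L n) j w)])
       - fine (Pr n [set w | C (deg_trunc (L n) M i w) (deg_trunc (L n) M j w)]) |
    <= e / 4.
  by near: M; exact: trunc.
pose A x : bool := x%:R <= M.
near=> n; rewrite sub0r normrN.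
have hC C : `|p n xpredT C - p n A C| <= e / 4 by exact: (hM n.+2 isT _ _ C).
have p01 B C : 0 <= p n B C <= 1.
  rewrite /p fine_ge0 //= -lee_fin fineK; last exact: finD.
  by apply: probability_le1; exact: measurable_deg_pair.
have indA : `|p n A C12 - p n A C1 * p n A C2| <= e / 4.
  apply: (le_trans (deg_trunc_near_indep s t (hmodel n.+2 isT) M0 _)) => //.
  have mK : (m n.+2)%:R / n.+2%:R <= mu + 1.
    by apply: hn0 => /=; do 2 apply: leqW; near: n; exact: nbhs_infty_ge.
  (* From this size on, [8 * M ^+ 2 * (mu + 1) / n.+2] is at most [e / 4]. *)
  have nM : 8 * M ^+ 2 * (mu + 1) / (e / 4) <= n.+2%:R.
    apply: (@le_trans _ _ n%:R); last by rewrite ler_nat; do 2 apply: leqW.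
    by near: n; exact: nbhs_infty_ger.
  have n0' : 0 < n.+2%:R :> R by rewrite ltr0n.
  rewrite (_ : _ * _ = 8 * M ^+ 2 * ((m n.+2)%:R / n.+2%:R) / n.+2%:R); last by field.
  rewrite ler_pdivrMr // mulrC; move: nM; rewrite ler_pdivrMr //.
  rewrite mulrC [leRHS]mulrC.
  by apply: le_trans; rewrite ler_wpM2l // mulr_ge0 ?exprn_ge0.
have h12 := hC C12; have h1 := hC C1; have h2 := hC C2.
(* With p for full and q for truncated probabilities, [p1 * p2 - q1 * q2 = (p1 - q1) * p2 + q1 * (p2
   - q2)]; so only [p2] and [q1] need the bounds 0 and 1. *)
have := p01 xpredT C2; have := p01 A C1.
move: h12 h1 h2 indA; rewrite !ler_norml.
nra.
Unshelve. all: by end_near. Qed.
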